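(* Let $\Theta(\omega)=\mathbb R^\omega\times\mathbb R_{>0}$ for finite non-empty sets $\omega$, with $\Theta(\psi)(\mu',s)=(\mu'\circ\psi,s)$, and let $g$ be the marginal dispersion, i.e. $g_{\omega_1}(\mu,s)=s$ and $g_{\omega_2}((\mu_1,\mu_2),s)=s+(\mu_1-\mu_2)^2/4$, where $\omega_1=\{*\}$ and $\omega_2=\{1,2\}$, with target constant at $T=\mathbb R_{>0}=g_{\omega_2}(\Theta(\omega_2))$. Let $r_{\omega_1},r_{\omega_2}:T\to T$ be any maps. If $r\circ g=(r_{\omega_1}g_{\omega_1},r_{\omega_2}g_{\omega_2})$ satisfies Tjur's condition at the reduction to the first group, i.e. if $$r_{\omega_1}\circ g_{\omega_1}\circ\Theta(i_1)=r_{\omega_2}\circ g_{\omega_2}$$ for the selection $i_1:\omega_1\to\omega_2$, $*\mapsto1$, then $r_{\omega_1}=r_{\omega_2}$ is constant. Hence no non-constant recalibration of the marginal dispersion is Tjur-natural, and a fortiori none is meaningful.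
   Context: A recalibration of $g$ is a family $r\circ g$ with $r_{\omega_1},r_{\omega_2}:T\to T$ maps (no measurability required). A family of maps $f_\omega:\Theta(\omega)\to T$ is natural at $\psi:\omega\to\omega'$ (with target constant at $T$, $\Lambda(\psi)=\mathrm{id}_T$) if $f_\omega\circ\Theta(\psi)=f_{\omega'}$. It is meaningful if natural at every map of covariate spaces, and Tjur-natural if natural at the insertions (proper inclusions of covariate spaces); under the identification of $\omega_1=\{*\}$ with $\{1\}$ the insertion $\{1\}\subsetneq\{1,2\}$ is $i_1$, and $\Theta(i_1)((\mu_1,\mu_2),s)=(\mu_1,s)$. *)

(* Defs.v *)
From HB Require Import structures.
From mathcomp Require Import all_boot all_order all_algebra.
From mathcomp Require Import boolp classical_sets reals interval_inference.

Set Implicit Arguments.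
Unset Strict Implicit.
Unset Printing Implicit Defensive.

Import Order.TTheory GRing.Theory Num.Theory.
Local Open Scope ring_scope.

Record covSpace := CovSpace {
  cov_sort :> finType;
  cov_gt0 : (0 < #|cov_sort|)%N }.

Section Families.
Variable R : realType.

Definition Theta (w : covSpace) : Type := ({ffun w -> R} * {posnum R})%type.

Definition Theta_map (w w' : covSpace) (psi : w -> w') (x : Theta w') :
    Theta w :=
  ([ffun a => x.1 (psi a)], x.2).

(* Families are indexed by the covariate spaces [om j], [j : J], on which they
   are defined; the maps between these are all the maps of sets. *)
Variables (J : Type) (om : J -> covSpace) (T : Type).

Definition family := forall j : J, Theta (om j) -> T.

Definition natural_at (f : family) (i j : J) (psi : om i -> om j) : Prop :=
  f i \o Theta_map psi = f j.

Definition meaningful (f : family) : Prop :=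
  forall (i j : J) (psi : om i -> om j), natural_at f psi.

(* Inclusion only makes sense for subsets of a common set: [lab j], meant to be
   injective, identifies [om j] with a subset of [U], and [psi] is an insertion when
   it is, under these identifications, the inclusion map of a proper subset. *)
Definition insertion (U : Type) (lab : forall j, om j -> U) (i j : J)
    (psi : om i -> om j) : Prop :=
  (forall a, lab j (psi a) = lab i a) /\
  (exists b, forall a, lab i a <> lab j b).

Definition Tjur_natural (U : Type) (lab : forall j, om j -> U) (f : family) :
    Prop :=
  forall (i j : J) (psi : om i -> om j),
    insertion lab psi -> natural_at f psi.

Definition constant_family (f : family) : Prop :=
  exists c : T, forall (j : J) (x : Theta (om j)), f j x = c.

Definition recalibration (r : J -> T -> T) (g : family) : family :=
  fun j => r j \o g j.

End Families.

Lemma card_unit_gt0 : (0 < #|{: unit}|)%N. Proof. by rewrite card_unit. Qed.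
Lemma card_ord2_gt0 : (0 < #|'I_2|)%N. Proof. by rewrite card_ord. Qed.

Variant groups := OneGroup | TwoGroups.

(* The elements 1 and 2 of the two-group space are encoded as 0 and 1 in
   ['I_2]; [group_label] restores the usual numbering and identifies the point
   of the one-group space with 1. *)
Definition omega (k : groups) : covSpace :=
  match k with
  | OneGroup => CovSpace card_unit_gt0
  | TwoGroups => CovSpace card_ord2_gt0
  end.

Definition group_label (k : groups) : omega k -> nat :=
  match k with
  | OneGroup => fun _ : unit => 1%N
  | TwoGroups => fun a : 'I_2 => a.+1
  end.

Definition i1 : omega OneGroup -> omega TwoGroups := fun _ => (ord0 : 'I_2).

Definition dispersion1 (R : realType) (x : Theta R (omega OneGroup)) :
    {posnum R} := x.2.

Lemma dispersion2_gt0 (R : realType) (s : {posnum R}) (m1 m2 : R) :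
  0 < s%:num + (m1 - m2) ^+ 2 / 4.
Proof. by rewrite ltr_wpDr// divr_ge0// sqr_ge0. Qed.

Definition dispersion2 (R : realType) (x : Theta R (omega TwoGroups)) :
    {posnum R} :=
  PosNum (dispersion2_gt0 x.2 (x.1 (ord0 : 'I_2)) (x.1 (ord_max : 'I_2))).

Definition marginal_dispersion (R : realType) : family R omega {posnum R} :=
  fun k =>
    match k with
    | OneGroup => @dispersion1 R
    | TwoGroups => @dispersion2 R
    end.

Arguments marginal_dispersion : clear implicits.

(* Main.v *)
Require Import Defs.
From mathcomp Require Import all_boot all_order all_algebra.
From mathcomp Require Import boolp classical_sets reals interval_inference.
From mathcomp Require Import ring.

(** Tjur's condition says that [r OneGroup s = r TwoGroups (s + d ^+ 2 / 4)] for
    every within-group variance [s] and every difference [d] of the two means: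
    reduction to the first group forgets the second mean, while the marginal
    dispersion increases with the distance between the means.  With [d = 0] the
    two recalibrations agree.  Since [d ^+ 2 / 4] takes every nonnegative value
    ([dispersion2_gap]), they agree moreover at any two comparable points, and
    the order on the positive reals is total, so the common value is a constant
    ([Tjur_condition_constant]).  The map [i1] is an insertion
    ([insertion_i1]), and a meaningful family is in particular natural at the
    insertions; this gives both negative conclusions. *)

Set Implicit Arguments.
Unset Strict Implicit.
Unset Printing Implicit Defensive.

Import Order.TTheory GRing.Theory Num.Theory.
Local Open Scope classical_set_scope.
Local Open Scope ring_scope.

(** Moving the two means apart raises the marginal dispersion from the
    within-group variance [s] to any larger value, without changing [s]. *)
Lemma dispersion2_gap (R : realType) (s t : {posnum R}) : s%:num <= t%:num ->
  exists2 x : Theta R (omega TwoGroups), x.2 = s & dispersion2 x = t.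
Proof.
move=> le_st.
(* Means [d] and [0], where [d] solves [d ^+ 2 / 4 = t - s]. *)
pose d : R := 2 * Num.sqrt (t%:num - s%:num).
pose mu : {ffun omega TwoGroups -> R} :=
  [ffun a : 'I_2 => if a == ord0 then d else 0].
exists (mu, s) => //; apply/val_inj => /=.
rewrite !ffunE /= subr0 exprMn sqr_sqrtr ?subr_ge0//.
by field.
Qed.

Lemma range_dispersion2 (R : realType) :
  range (@dispersion2 R) = [set: {posnum R}].
Proof.
apply/seteqP; split=> // t _.
by have [x _ xt] := dispersion2_gap (lexx t%:num); exists x.
Qed.

(** For [s <= t], a point with within-group variance [s] and marginal dispersion
    [t] turns the condition into [r1 s = r2 t].  The case [s = t] identifies
    [r1] with [r2], and comparing an arbitrary point with [1] gives constancy. *)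
Lemma Tjur_condition_constant (R : realType) (T : Type)
    (r1 r2 : {posnum R} -> T) :
  r1 \o @dispersion1 R \o Theta_map i1 = r2 \o @dispersion2 R ->
  r1 = r2 /\ exists c : T, r1 = fun=> c.
Proof.
move=> tjur.
have le_eq (s t : {posnum R}) : s%:num <= t%:num -> r1 s = r2 t.
  by move=> /dispersion2_gap[x <- <-]; exact: (congr1 (@^~ x) tjur).
have r12 : r1 = r2 by apply/funext => s; exact: le_eq.
split=> //; exists (r1 1%:pos); apply/funext => s.
have [le_s1|/ltW le_1s] := leP s%:num 1%:pos%:num.
  by rewrite (le_eq _ _ le_s1) r12.
by rewrite (le_eq _ _ le_1s) -r12.
Qed.

Lemma insertion_i1 : insertion group_label i1.
Proof.
(* The second group is the one outside the image. *)
by split=> //; exists (ord_max : 'I_2).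
Qed.

Lemma meaningful_Tjur_natural (R : realType) (J : Type) (om : J -> covSpace)
    (T U : Type) (lab : forall j, om j -> U) (f : Defs.family R om T) :
  meaningful f -> Tjur_natural lab f.
Proof. by move=> nat_f i j psi _; exact: nat_f. Qed.

Lemma Tjur_natural_recalibration_constant (R : realType)
    (r : groups -> {posnum R} -> {posnum R}) :
  let rg := recalibration r (marginal_dispersion R) in
  Tjur_natural group_label rg -> constant_family rg.
Proof.
move=> rg /(_ _ _ _ insertion_i1) /Tjur_condition_constant[r12 [c r1c]].
exists c => -[] x; first exact: (congr1 (@^~ _) r1c).
by rewrite /rg /recalibration /= -r12 r1c.
Qed.

Theorem proposition6p11 (R : realType) :
  let g := marginal_dispersion R in
  [/\ range (g TwoGroups) = [set: {posnum R}],
      (forall r : groups -> {posnum R} -> {posnum R},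
        r OneGroup \o g OneGroup \o Theta_map i1 = r TwoGroups \o g TwoGroups ->
        r OneGroup = r TwoGroups /\
        exists c : {posnum R}, r OneGroup = fun=> c),
      (forall r : groups -> {posnum R} -> {posnum R},
        ~ constant_family (recalibration r g) ->
        ~ Tjur_natural group_label (recalibration r g)) &
      (forall r : groups -> {posnum R} -> {posnum R},
        ~ constant_family (recalibration r g) ->
        ~ meaningful (recalibration r g))].
Proof.
split.
- exact: range_dispersion2.
- by move=> r; exact: Tjur_condition_constant.
- by move=> r nconst /Tjur_natural_recalibration_constant.
- move=> r nconst /(meaningful_Tjur_natural (lab := group_label)).
  by move/Tjur_natural_recalibration_constant.
Qed.
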